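(* Let $N\ge 1$, let $\rho=\sum_{n=0}^N\chi_n\,|D_{N,n}\rangle\langle D_{N,n}|$ be a general diagonal symmetric (GDS) state of $N$ qubits, and put $m_0:=\lfloor N/2\rfloor$. Then $\rho$ is separable if and only if it is PPT. More precisely, for any set $A\subseteq\{1,\dots,N\}$ of $m_0$ subsystems, $\rho$ is separable if and only if the partial transpose $\rho^{\Gamma_A}$ is positive semidefinite.
   Context: Let $|0\rangle,|1\rangle$ be the standard orthonormal basis of $\mathbb{C}^2$. For $0\le n\le N$ the unnormalized $N$-qubit Dicke state is the vector $|D_{N,n}\rangle\in(\mathbb{C}^2)^{\otimes N}$ equal to the sum of all $\binom{N}{n}$ distinct standard basis vectors $|x_1\rangle\otimes\cdots\otimes|x_N\rangle$ with $x\in\{0,1\}^N$ having exactly $n$ entries equal to $0$ (and $N-n$ entries equal to $1$); equivalently, $(|1\rangle+z|0\rangle)^{\otimes N}=\sum_{n=0}^N z^n|D_{N,n}\rangle$ for all $z\in\mathbb{C}$. A quantum state is a positive semidefinite operator of trace one. A general diagonal symmetric (GDS) state is a quantum state of the form $\rho=\sum_{n=0}^N\chi_n|D_{N,n}\rangle\langle D_{N,n}|$ (so $\chi_n\ge 0$ for all $n$). A state on $(\mathbb{C}^2)^{\otimes N}$ is separable if it is a finite convex combination of product states $\alpha_1\otimes\cdots\otimes\alpha_N$, each $\alpha_k$ being a state on $\mathbb{C}^2$. For $A\subseteq\{1,\dots,N\}$, the partial transpose $\rho^{\Gamma_A}$ is obtained by applying the transposition map (in the standard basis) to the tensor factors indexed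 by $A$ and the identity map to the others. The state $\rho$ is PPT if $\rho^{\Gamma_A}$ is positive semidefinite for every $A\subseteq\{1,\dots,N\}$. *)

(* Defs.v *)
From HB Require Import structures.
From mathcomp Require Import all_boot all_order all_algebra.
From mathcomp Require Import reals complex.

Set Implicit Arguments.
Unset Strict Implicit.
Unset Printing Implicit Defensive.

Import Order.TTheory GRing.Theory Num.Theory.
Local Open Scope ring_scope.
Local Open Scope complex_scope.
Local Open Scope sesquilinear_scope.

(* The complex numbers are R[i] with R : realType. The standard basis of the
   N-fold tensor power of C^2 is labelled by the bit strings x : {0,1}^N;
   enum_rank and label translate between bit strings and matrix indices. *)
Notation bits N := {ffun 'I_N -> 'I_2}.

Definition qdim (N : nat) : nat := #|{: bits N}|.

Definition label (N : nat) (i : 'I_(qdim N)) : bits N := enum_val i.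

Definition tensor_vec (R : realType) (N : nat) (v : 'I_N -> 'cV[R[i]]_2) :
    'cV[R[i]]_(qdim N) :=
  \col_i \prod_(k < N) v k (label i k) 0.

Definition tensor_op (R : realType) (N : nat) (a : 'I_N -> 'M[R[i]]_2) :
    'M[R[i]]_(qdim N) :=
  \matrix_(i, j) \prod_(k < N) a k (label i k) (label j k).

Definition qubit_ket (R : realType) (b : 'I_2) : 'cV[R[i]]_2 := delta_mx b 0.

Definition ket (R : realType) (N : nat) (x : bits N) : 'cV[R[i]]_(qdim N) :=
  tensor_vec (fun k => qubit_ket R (x k)).

(* Unnormalized; n counts the entries equal to 0. *)
Definition dicke (R : realType) (N n : nat) : 'cV[R[i]]_(qdim N) :=
  \sum_(x : bits N | #|[set k | x k == 0]| == n) ket R x.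

(* On R[i], 0 <= z means that z is real and nonnegative. *)
Definition psd (R : realType) (d : nat) (M : 'M[R[i]]_d) : Prop :=
  M \is hermsymmx /\ forall v : 'cV[R[i]]_d, 0 <= (v ^t* *m M *m v) 0 0.

Definition is_state (R : realType) (d : nat) (M : 'M[R[i]]_d) : Prop :=
  psd M /\ \tr M = 1.

(* The coefficients are arbitrary complex numbers: that they are real and
   nonnegative follows when the operator is a state. *)
Definition gds (R : realType) (N : nat) (chi : 'I_N.+1 -> R[i]) :
    'M[R[i]]_(qdim N) :=
  \sum_(n < N.+1) chi n *: (dicke R N n *m (dicke R N n) ^t*).

Definition separable (R : realType) (N : nat) (rho : 'M[R[i]]_(qdim N)) : Prop :=
  exists (m : nat) (p : 'I_m -> R) (a : 'I_m -> 'I_N -> 'M[R[i]]_2),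
    [/\ forall l, 0 <= p l,
        \sum_(l < m) p l = 1,
        forall l k, is_state (a l k) &
        rho = \sum_(l < m) (p l)%:C *: tensor_op (a l)].

(* The string equal to y on A and to x off A. *)
Definition splice (N : nat) (A : {set 'I_N}) (x y : bits N) : bits N :=
  [ffun k => if k \in A then y k else x k].

(* Exchanging the row and column labels on the factors in A is the linear map
   that transposes these factors; see ptranspose_tensor_op. *)
Definition ptranspose (R : realType) (N : nat) (A : {set 'I_N})
    (rho : 'M[R[i]]_(qdim N)) : 'M[R[i]]_(qdim N) :=
  \matrix_(i, j) rho (enum_rank (splice A (label i) (label j)))
                     (enum_rank (splice A (label j) (label i))).

Definition ppt (R : realType) (N : nat) (rho : 'M[R[i]]_(qdim N)) : Prop :=
  forall A : {set 'I_N}, psd (ptranspose A rho).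

Lemma ptranspose_tensor_op (R : realType) (N : nat) (A : {set 'I_N})
    (a : 'I_N -> 'M[R[i]]_2) :
  ptranspose A (tensor_op a) =
  tensor_op (fun k => if k \in A then (a k)^T else a k).
Proof.
apply/matrixP => i j; rewrite !mxE; apply: eq_bigr => k _.
by rewrite /label !enum_rankK !ffunE; case: ifP => // _; rewrite mxE.
Qed.

Lemma dicke_generating (R : realType) (N : nat) (z : R[i]) :
  tensor_vec (fun _ : 'I_N => qubit_ket R 1 + z *: qubit_ket R 0) =
  \sum_(n < N.+1) z ^+ n *: dicke R N n.
Proof.
apply/matrixP => i j; rewrite summxE !mxE.
have bitE (b : 'I_2) : (qubit_ket R 1 + z *: qubit_ket R 0) b 0 =
    if b == 0 then z else 1.
  by rewrite !mxE; case: b => [[|[|//]] ?];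
     rewrite !(eqxx, andbT, andbF) /= ?mulr0 ?mulr1 ?addr0 ?add0r.
have ketE (x : bits N) : ket R x i j = (label i == x)%:R.
  rewrite mxE; case: eqP => [->|neq].
    by rewrite big1 // => k _; rewrite mxE !eqxx.
  have [k nk] : exists k, label i k != x k.
    by apply/existsP; rewrite -negb_forall; apply/negP => /forallP h;
       apply: neq; apply/ffunP => k; apply/eqP.
  by rewrite (bigD1 k) //= mxE (negbTE nk) mul0r.
have ltc : (#|[set k | label i k == 0%R]| < N.+1)%N.
  by rewrite ltnS (leq_trans (max_card _)) // card_ord.
rewrite (eq_bigr (fun k => if label i k == 0%R then z else 1%R)) => [|k _];
  last exact: bitE.
rewrite -big_mkcond /= prodr_const (bigD1 (Ordinal ltc)) //= big1 ?addr0.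
  rewrite mxE summxE (bigD1 (label i)) //= ketE eqxx big1 ?addr0 => [|x /andP[_ nx]].
    by rewrite mulr1; congr (_ ^+ _); apply: eq_card => k; rewrite !inE.
  by rewrite ketE eq_sym (negbTE nx).
move=> n nn; rewrite mxE summxE big1 ?mulr0 // => x /eqP xn.
rewrite ketE; case: eqP => // ex; case/eqP: nn; apply: val_inj => /=.
by rewrite ex xn.
Qed.

(* Main.v *)
Require Import Defs.
From HB Require Import structures.
From mathcomp Require Import all_boot all_order all_algebra cyclic.
From mathcomp Require separable cyclotomic.
From mathcomp Require Import boolp reals complex ring lra zify.
Set Implicit Arguments.
Unset Strict Implicit.
Unset Printing Implicit Defensive.
Import Order.TTheory GRing.Theory Num.Theory.
Local Open Scope ring_scope.

(* Let L be the functional X^n |-> chi_n on polynomials of degree <= N.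
   Testing the partial transpose over floor(N/2) subsystems against
   combinations of basis strings gives L(f^2) >= 0 and L(X g^2) >= 0 whenever
   these arguments have degree <= N: the truncated Stieltjes conditions.
   Under them some monic f of degree k <= (N+1)/2 is L-orthogonal to all
   polynomials of degree < max(k, N-k): either an orthogonal polynomial or a
   null vector of minimal degree. Its roots are simple and nonnegative, and
   Lagrange interpolation there yields
     chi_n = sum_t w_t t^n + c [n = N]   with w_t, c >= 0,
   the last term being an atom at infinity. Finally sum_n t^n |D_n><D_n| is the
   average of the product states generated by |1> + z|0> over the z with
   |z|^2 = t that are sqrt t times (N+1)-st roots of unity. *)

(** * The truncated Stieltjes moment problem *)

(** A complex root z = a + ib exists because [R[i]] is algebraically closed. If b = 0 it is a real
    root; otherwise (X - a)^2 + b^2 is the minimal polynomial of z over [R]. *)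
Lemma real_or_quadratic_factor (R : rcfType) (p : {poly R}) :
  (1 < size p)%N ->
  (exists a q, p = ('X - a%:P) * q) \/
  (exists a b q, b != 0 /\ p = (('X - a%:P) ^+ 2 + (b ^+ 2)%:P) * q).
Proof.
move=> sp; pose h := real_complex R.
have /closed_rootP[z rz] : size (map_poly h p) != 1%N.
  by rewrite size_map_poly; case: (size p) sp => [|[]].
pose a := complex.Re z; pose b := complex.Im z.
have [b0|b0] := eqVneq b 0.
  left; exists a; have : root p a.
    rewrite -(fmorph_root h); move: rz.
    by rewrite [z]complexE -/b -/a b0 mulr0 addr0.
  by case/factor_theorem => q ->; exists q; rewrite mulrC.
right; pose g : {poly R} := ('X - a%:P) ^+ 2 + (b ^+ 2)%:P.
have gm : map_poly h g = ('X - (h a)%:P) ^+ 2 + (h b ^+ 2)%:P.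
  by rewrite rmorphD rmorphXn rmorphB /= map_polyX !map_polyC -[h b ^+ 2]rmorphXn.
have sX : size (('X - a%:P) ^+ 2) = 3%N by rewrite size_exp_XsubC.
have sg : size g = 3%N.
  by rewrite size_polyDl ?sX //; apply: leq_ltn_trans (size_polyC_leq1 _) _.
have gz : (map_poly h g).[z] = 0.
  rewrite gm !hornerE /= [z]complexE -/a -/b.
  rewrite [_ + _ - _]addrC addKr exprMn sqr_i mulN1r addNr //.
have g0 : g != 0 by rewrite -size_poly_eq0 sg.
(* The remainder is r1 X + r0 with real coefficients and vanishes at z: the imaginary part r1 b
   forces r1 = 0, hence r0 = 0. *)
have /eqP r0 : modp p g == 0.
  have sr : (size (modp p g) < 3)%N by rewrite -sg ltn_modp.
  have rz0 : (map_poly h (modp p g)).[z] = 0.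
    move/rootP: rz; rewrite {1}(divp_eq p g) rmorphD rmorphM /= hornerD hornerM gz.
    by rewrite mulr0 add0r.
  set r := modp p g in sr rz0 *.
  have rE : r = r`_1 *: 'X + (r`_0)%:P.
    apply/polyP => i; rewrite !coefE; case: i => [|[|i]];
      rewrite ?mulr0 ?mulr1 ?add0r ?addr0 //.
    by rewrite nth_default ?scaler0 ?addr0 // (leq_trans _ (leq_addr _ 2%N)).
  move: rz0; rewrite rE rmorphD /= map_polyZ map_polyX map_polyC !hornerE.
  rewrite [z]complexE -/a -/b.
  rewrite /h; simpc => -[/eqP e1 /eqP e2].
  move: e2; rewrite mulf_eq0 (negbTE b0) orbF => /eqP e2.
  by move: e1; rewrite e2 mul0r add0r scale0r add0r => /eqP ->.
by exists a, b, (divp p g); split=> //; rewrite {1}(divp_eq p g) r0 addr0 mulrC.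
Qed.

Lemma monic_prod_XsubC (R : rcfType) (P : R -> Prop) (f : {poly R}) :
  f \is monic ->
  (forall a q, f = ('X - a%:P) * q -> P a) ->
  (forall a q, f <> ('X - a%:P) ^+ 2 * q) ->
  (forall a b q, b != 0 -> f <> (('X - a%:P) ^+ 2 + (b ^+ 2)%:P) * q) ->
  exists s : seq R, [/\ uniq s, forall t, t \in s -> P t &
    f = \prod_(t <- s) ('X - t%:P)].
Proof.
move=> fm fP f2 fq.
suff [s fs] : exists s : seq R, f = \prod_(t <- s) ('X - t%:P).
  exists s; split=> //.
    apply/(uniqP 0) => i j; rewrite !inE => si sj eij; apply/eqP/negPn/negP => nij.
    wlog ltij : i j si sj eij nij / (i < j)%N => [hw|].
      move: (nij); rewrite neq_ltn => /orP[h|h]; first exact: (hw i j).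
      by apply: (hw j i) => //; rewrite eq_sym.
    (* Equal entries at positions i < j would give a double root; the cofactor collects the three
       pieces of [s] around them. *)
    apply: (f2 s`_i (\prod_(t <- take i s ++ take (j - i.+1) (drop i.+1 s)
                               ++ drop j.+1 s) ('X - t%:P))).
    rewrite {1}fs -{1}(cat_take_drop i s) (drop_nth 0 si).
    rewrite -{1}(cat_take_drop (j - i.+1) (drop i.+1 s)) drop_drop
      subnK // (drop_nth 0 sj) -eij.
    by rewrite !(big_cat, big_cons) /=; ring.
  move=> t ts; apply: (fP t (\prod_(u <- rem t s) ('X - u%:P))).
  by rewrite fs (perm_big _ (perm_to_rem ts)) big_cons.
have monic1 (g : {poly R}) : (size g <= 1)%N -> g \is monic -> g = 1.
  by move=> /size1_polyC gc /monicP; rewrite gc lead_coefC => ->.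
(* The cofactor [h] stores the linear factors already split off, so that the exclusion of quadratic
   factors, stated for [f], applies to every [g]. *)
suff : forall n (g h : {poly R}), (size g <= n.+1)%N -> g \is monic -> f = g * h ->
    exists s : seq R, g = \prod_(t <- s) ('X - t%:P).
  by move=> /(_ (size f) f 1); apply => //; rewrite ?mulr1.
elim=> [|n IH] g h sg gm fg.
  by exists [::]; rewrite big_nil; apply: monic1.
have [s1|s1] := leqP (size g) 1.
  by exists [::]; rewrite big_nil; apply: monic1.
have [[a [q gq]]|[a [b [q [b0 gq]]]]] := real_or_quadratic_factor s1; last first.
  by case: (fq a b (q * h) b0); rewrite fg gq mulrA.
have qm : q \is monic by move: gm; rewrite gq monicMl // monicXsubC.
have sq : (size q <= n.+1)%N.
  by move: sg; rewrite gq size_Mmonic ?polyXsubC_eq0 // size_XsubC add2n.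
have [|s qs] := IH q (('X - a%:P) * h) sq qm; first by rewrite fg gq; ring.
by exists (a :: s); rewrite big_cons gq qs.
Qed.

(* [e + 2d <= N] is the degree bound: squares for e = 0, X times squares for e = 1. *)
Definition stieltjes_pos (R : rcfType) (N : nat) (L : {scalar {poly R}}) :=
  forall (e : bool) (d : nat) (f : {poly R}),
    (size f <= d.+1)%N -> (e + d.*2 <= N)%N -> 0 <= L ('X^e * f ^+ 2).

(** The roots of [f] will be the quadrature nodes. The bound N - k lets f q run through degrees
    below N; when 2k = N + 1 the bound is k, as for Gauss quadrature, and f q reaches degree N. *)
Definition quadrature_poly (R : rcfType) (N : nat) (L : {scalar {poly R}})
    (k : nat) (f : {poly R}) :=
  [/\ f \is monic, size f = k.+1,
      forall g : {poly R}, (size g <= k)%N -> g != 0 -> 0 < L (g ^+ 2) &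
      forall q : {poly R}, (size q <= maxn k (N - k))%N -> L (f * q) = 0].

(** Cauchy-Schwarz for the semidefinite form (f, h) -> L(X^e f h): a null vector lies in the
    radical. *)
Lemma stieltjes_pos_null (R : rcfType) N (L : {scalar {poly R}})
    (e : bool) d (f h : {poly R}) :
  stieltjes_pos N L -> (e + d.*2 <= N)%N -> (size f <= d.+1)%N ->
  (size h <= d.+1)%N -> L ('X^e * f ^+ 2) = 0 -> L ('X^e * (f * h)) = 0.
Proof.
move=> Lp ed sf sh f0.
set b := L _; pose a := L ('X^e * h ^+ 2).
have a0 : 0 <= a by apply: Lp sh ed.
have quad x : 0 <= 2 * x * b + x ^+ 2 * a.
  have <- : L ('X^e * (f + x *: h) ^+ 2) = 2 * x * b + x ^+ 2 * a.
    have -> : 'X^e * (f + x *: h) ^+ 2 = 'X^e * f ^+ 2 +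
        (2 * x) *: ('X^e * (f * h)) + x ^+ 2 *: ('X^e * h ^+ 2).
      by rewrite -!mul_polyC !polyCM /=; ring.
    by rewrite !linearD !linearZ /= f0 add0r.
  apply: Lp ed => //; rewrite (leq_trans (size_polyD _ _)) // geq_max sf.
  by rewrite (leq_trans (size_scale_leq _ _)).
have a1 : a + 1 != 0 by lra.
(* Dividing by a + 1 rather than by a also covers a = 0; the value is a negative multiple of b^2. *)
have := quad (- b / (a + 1)).
have -> : 2 * (- b / (a + 1)) * b + (- b / (a + 1)) ^+ 2 * a
   = - ((b ^+ 2 * (a + 2)) / (a + 1) ^+ 2) by field.
rewrite oppr_ge0 pmulr_lle0 ?invr_gt0 ?exprn_gt0; try lra.
rewrite pmulr_lle0; last by lra.
by move=> h2; apply/eqP; rewrite -sqrf_eq0 eq_le h2 sqr_ge0.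
Qed.

(** The Gram matrix of 1, ..., X^(k-1) is positive definite, hence invertible, so X^k has an
    orthogonal projection onto their span; [f] is X^k minus that projection. *)
Lemma orthogonal_poly (R : rcfType) (L : {scalar {poly R}}) k :
  (forall g : {poly R}, (size g <= k)%N -> g != 0 -> 0 < L (g ^+ 2)) ->
  exists f : {poly R}, [/\ f \is monic, size f = k.+1 &
    forall q : {poly R}, (size q <= k)%N -> L (f * q) = 0].
Proof.
move=> Lp.
pose G : 'M[R]_k := \matrix_(i, j) L ('X^i * 'X^j).
have rVE (u : 'rV[R]_k) : rVpoly u = \sum_(i < k) u 0 i *: 'X^i.
  by rewrite [u in LHS]row_sum_delta linear_sum; apply: eq_bigr => i _;
     rewrite linearZ /= rVpoly_delta.
have LE (p : {poly R}) (v : 'rV[R]_k) :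
    L (p * rVpoly v) = ((\row_j L (p * 'X^j)) *m v^T) 0 0.
  rewrite rVE mulr_sumr linear_sum mxE; apply: eq_bigr => j _.
  by rewrite -scalerAr linearZ /= !mxE mulrC; congr (L _ * _); rewrite mulrC.
have GE (u : 'rV[R]_k) : \row_j L (rVpoly u * 'X^j) = u *m G.
  apply/rowP => j; rewrite !mxE rVE mulr_suml linear_sum; apply: eq_bigr => i _.
  by rewrite -scalerAl linearZ !mxE.
have Gu : G \in unitmx.
  rewrite -row_free_unit -kermx_eq0; apply/eqP/row_matrixP => i.
  rewrite row0; set u := row i _.
  have uG : u *m G = 0 by apply/sub_kermxP/row_sub.
  apply/eqP; apply: contraT => u0.
  have r0 : rVpoly u != 0.
    by apply: contraNneq u0 => /(congr1 (@poly_rV _ k)); rewrite rVpolyK linear0 => ->.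
  by have := Lp (rVpoly u) (size_poly _ _) r0; rewrite expr2 LE GE uG mul0mx mxE ltxx.
pose u : 'rV_k := \row_j L ('X^k * 'X^j) *m invmx G.
have sr : (size (rVpoly u) < k.+1)%N by rewrite ltnS size_poly.
exists ('X^k - rVpoly u); split.
- by rewrite monicE lead_coefDl ?size_polyN ?size_polyXn // lead_coefXn.
- by rewrite size_polyDl ?size_polyN ?size_polyXn.
move=> q sq; rewrite -(poly_rV_K sq) mulrBl linearB /= !LE GE mulmxKV //.
by rewrite subrr.
Qed.

Lemma size_XnM_leq (R : nzSemiRingType) (n m : nat) (p : {poly R}) :
  (size p <= m)%N -> (size ('X^n * p)%R <= n + m)%N.
Proof.
move=> sp; apply: leq_trans (size_polyMleq _ _) _.
by rewrite size_polyXn addSn leq_add2l.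
Qed.

(** Cauchy-Schwarz alone handles deg q <= k. Higher degrees follow one at a time, as long as f q
    stays of degree below N; degree N itself escapes, which leaves room for the atom at infinity. *)
Lemma null_poly_orthogonal (R : rcfType) N (L : {scalar {poly R}}) k (f : {poly R}) :
  stieltjes_pos N L -> (k.*2 <= N)%N -> (size f <= k.+1)%N -> L (f ^+ 2) = 0 ->
  forall q : {poly R}, (size q <= maxn k.+1 (N - k))%N -> L (f * q) = 0.
Proof.
move=> Lp kN sf f0.
have base (q : {poly R}) : (size q <= k.+1)%N -> L (f * q) = 0.
  move=> sq; have := @stieltjes_pos_null _ _ _ false k f q Lp kN sf sq.
  by rewrite expr0 !mul1r; apply.
suff step d (q : {poly R}) : (size q <= k.+1 + d)%N -> (k.*2 + d < N)%N -> L (f * q) = 0.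
  move=> q; rewrite leq_max => /orP[/base //|sq].
  have [kN1|kN1] := ltnP k.*2 N; last by apply: base; apply: leq_trans sq _; lia.
  by apply: (step (N - k.*2).-1); [apply: leq_trans sq _|]; lia.
elim: d q => [|d IH] q sq dN; first by apply: base; rewrite -(addn0 k.+1).
have IH' (p : {poly R}) : (size p <= k.+1 + d)%N -> L (f * p) = 0.
  by move=> sp; apply: IH => //; lia.
(* Split X^(k+1+d) f = X^e (X^a f) X^b with d = e + 2a: by induction X^a f is
   null for the form of parity e, so Cauchy-Schwarz applies. *)
have X0 : L (f * 'X^(k.+1 + d)) = 0.
  have [e [a dE]] : exists (e : bool) a, d = (e + a.*2)%N.
    by exists (odd d), d./2; rewrite odd_double_half.
  have [b bE] : exists b, (k.+1 + d = e + a + b)%N by exists (k.+1 + a)%N; lia.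
  have := @stieltjes_pos_null _ N L e (k + a).+1 ('X^a * f) 'X^b Lp.
  have -> : 'X^e * ('X^a * f * 'X^b) = f * 'X^(k.+1 + d) :> {poly R}.
    by rewrite bE !exprD; ring.
  have -> : 'X^e * ('X^a * f) ^+ 2 = f * ('X^d * f) :> {poly R}.
    by rewrite [in RHS]dE exprD -muln2 exprM; ring.
  apply; first by lia.
  - by apply: leq_trans (size_XnM_leq _ sf) _; lia.
  - by rewrite size_polyXn; lia.
  by apply: IH'; rewrite addnC size_XnM_leq.
pose c := q`_(k.+1 + d); pose r := q - c *: 'X^(k.+1 + d).
have -> : q = r + c *: 'X^(k.+1 + d) by rewrite subrK.
rewrite mulrDr linearD /= -scalerAr linearZ /= X0 mulr0 addr0 IH' //.
apply/leq_sizeP => j kj; rewrite !coefE.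
have [->|nj] := eqVneq j (k.+1 + d)%N; first by rewrite mulr1 subrr.
by rewrite mulr0 subr0 nth_default // (leq_trans sq) // addnS ltn_neqAle eq_sym nj.
Qed.

Lemma stieltjes_quadrature_poly (R : rcfType) N (L : {scalar {poly R}}) :
  stieltjes_pos N L ->
  exists k f, (k.*2 <= N.+1)%N /\ quadrature_poly N L k f.
Proof.
move=> Lp.
(* The minimal such k is the least degree of a monic null polynomial, capped at ceil(N/2). At the
   cap max(k, N - k) = k, so an orthogonal polynomial suffices; below it 2k <= N and the null
   polynomial serves. *)
pose P k := `[< exists f : {poly R}, [/\ f \is monic, size f = k.+1 &
  L (f ^+ 2) = 0] >] || (k == uphalf N).
have exP : exists k, P k by exists (uphalf N); rewrite /P eqxx orbT.
have [k Pk kmin] := ex_minnP exP.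
have kN : (k <= uphalf N)%N by apply: kmin; rewrite /P eqxx orbT.
have k2 : (k.*2 <= N.+1)%N by move: kN; lia.
have pos (g : {poly R}) : (size g <= k)%N -> g != 0 -> 0 < L (g ^+ 2).
  move=> sg g0.
  have s0 : (0 < size g)%N by rewrite size_poly_gt0.
  rewrite lt_neqAle; apply/andP; split; last first.
    have := Lp false (size g).-1 g; rewrite expr0 mul1r; apply.
      by rewrite prednK.
    by move: sg s0 k2; lia.
  apply/negP => /eqP gz.
  (* A nonzero null [g], made monic, would contradict the minimality of k. *)
  have : (k <= (size g).-1)%N.
    apply: kmin; apply/orP; left; apply/asboolP; exists ((lead_coef g)^-1 *: g).
    have l0 : (lead_coef g)^-1 != 0 by rewrite invr_eq0 lead_coef_eq0.
    split.
    - by rewrite monicE lead_coefZ mulVf // lead_coef_eq0.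
    - by rewrite size_scale // prednK.
    - by rewrite exprZn linearZ /= -gz mulr0.
  by move: sg s0; lia.
exists k.
have [kE|kne] := eqVneq k (uphalf N).
  have [f [fm sf fo]] := orthogonal_poly pos; exists f; split=> //; split=> // q sq.
  by apply: fo; apply: leq_trans sq _; lia.
move: Pk; rewrite /P (negbTE kne) orbF => /asboolP[f [fm sf f0]].
exists f; split=> //; split=> // q sq.
apply: (null_poly_orthogonal Lp _ _ f0 (k := k)); rewrite ?sf //; first by lia.
by apply: leq_trans sq _; lia.
Qed.

(** Each factorization of [f] is tested against its cofactor q. From f = (X - a) q comes L(X q^2) =
    a L(q^2), so a >= 0. A double root or a conjugate pair makes f q a square, or a sum of squares,
    on which L is positive, against L(f q) = 0. *)
Lemma quadrature_poly_roots (R : rcfType) N (L : {scalar {poly R}}) k f :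
  stieltjes_pos N L -> (k.*2 <= N.+1)%N -> quadrature_poly N L k f ->
  exists s : seq R, [/\ uniq s, forall t, t \in s -> 0 <= t &
    f = \prod_(t <- s) ('X - t%:P)].
Proof.
move=> Lp kN [fm sf pos fo].
have f0 := monic_neq0 fm.
have fo' (q : {poly R}) : (size q <= k)%N -> L (f * q) = 0.
  by move=> sq; apply: fo; rewrite leq_max sq.
apply: monic_prod_XsubC => // [a q fq|a q fq|a b q b0 fq].
- have q0 : q != 0 by apply: contraNneq f0 => q0; rewrite fq q0 mulr0.
  have sq : size q = k.
    by move: sf; rewrite fq size_monicM ?monicXsubC // size_XsubC add2n => -[].
  have k0 : (0 < k)%N by rewrite -sq size_poly_gt0.
  have := fo' q; rewrite sq => /(_ (leqnn k)).
  have -> : f * q = 'X * q ^+ 2 - a *: q ^+ 2 by rewrite fq -mul_polyC; ring.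
  rewrite linearB linearZ /= => /eqP; rewrite subr_eq0 => /eqP E.
  have := Lp true k.-1 q; rewrite sq prednK // E => /(_ (leqnn _)).
  rewrite pmulr_lge0; last by apply: pos; rewrite ?sq.
  by apply; move: kN k0; lia.
- have q0 : q != 0 by apply: contraNneq f0 => q0; rewrite fq q0 mulr0.
  have sq : (size q).+1 = k.
    by move: sf; rewrite fq size_monicM ?monic_exp ?monicXsubC // size_exp_XsubC => -[].
  have := fo' q; rewrite -sq => /(_ (leqnSn _)).
  have -> : f * q = (('X - a%:P) * q) ^+ 2 by rewrite fq; ring.
  apply/eqP; rewrite gt_eqF //; apply: pos; last by rewrite mulf_neq0 ?polyXsubC_eq0.
  by rewrite size_monicM ?monicXsubC // size_XsubC add2n sq.
- have q0 : q != 0 by apply: contraNneq f0 => q0; rewrite fq q0 mulr0.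
  have sg : size (('X - a%:P) ^+ 2 + (b ^+ 2)%:P) = 3%N.
    rewrite size_polyDl size_exp_XsubC //.
    by apply: leq_ltn_trans (size_polyC_leq1 _) _.
  have sq : (size q).+1 = k.
    by move: sf; rewrite fq size_mul // -?size_poly_eq0 sg // => -[].
  have := fo' q; rewrite -sq => /(_ (leqnSn _)).
  have -> : f * q = (('X - a%:P) * q) ^+ 2 + b ^+ 2 *: q ^+ 2.
    by rewrite fq -mul_polyC polyC_exp; ring.
  rewrite linearD linearZ /=; apply/eqP; rewrite gt_eqF //.
  apply: addr_gt0; last by rewrite mulr_gt0 ?exprn_even_gt0 //; apply: pos; rewrite -?sq.
  apply: pos; last by rewrite mulf_neq0 ?polyXsubC_eq0.
  by rewrite size_monicM ?monicXsubC // size_XsubC add2n sq.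
Qed.

(** * Lagrange interpolation and quadrature *)

Definition lagrange_basis (R : fieldType) (s : seq R) (t : R) : {poly R} :=
  (\prod_(u <- rem t s) (t - u))^-1 *: \prod_(u <- rem t s) ('X - u%:P).

Lemma lagrange_basisE (R : fieldType) (s : seq R) t u :
  uniq s -> t \in s -> u \in s -> (lagrange_basis s t).[u] = (u == t)%:R.
Proof.
move=> us ts ut; rewrite /lagrange_basis hornerZ horner_prod.
have E v : \prod_(x <- rem t s) ('X - x%:P).[v] = \prod_(x <- rem t s) (v - x).
  by apply: eq_bigr => x _; rewrite hornerXsubC.
rewrite E; have [->|nut] := eqVneq u t.
  rewrite mulVf // prodf_seq_neq0; apply/allP => x.
  by rewrite mem_rem_uniq // inE subr_eq0 eq_sym => /andP[].
have ur : u \in rem t s by rewrite mem_rem_uniq // inE nut.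
by rewrite [X in _ * X](big_rem u ur) /= subrr mul0r mulr0.
Qed.

Lemma size_lagrange_basis (R : fieldType) (s : seq R) t :
  t \in s -> (size (lagrange_basis s t) <= size s)%N.
Proof.
move=> ts; apply: leq_trans (size_scale_leq _ _) _.
by rewrite size_prod_XsubC size_rem // prednK //; case: s ts.
Qed.

(** A polynomial minus its interpolant at the roots of f is a multiple of f, so L agrees with the
    quadrature rule below degree N. The constant [c] is the defect at X^N. *)
Lemma truncated_stieltjes (R : rcfType) N (L : {scalar {poly R}}) :
  stieltjes_pos N L ->
  exists (s : seq R) (w : R -> R) (c : R),
    [/\ forall t, t \in s -> 0 <= t /\ 0 <= w t, 0 <= c &
        forall n, (n <= N)%N -> L 'X^n = \sum_(t <- s) w t * t ^+ n + c *+ (n == N)].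
Proof.
move=> Lp; have [k [f [kN qf]]] := stieltjes_quadrature_poly Lp.
have [s [us s0 fs]] := quadrature_poly_roots Lp kN qf.
case: qf => fm sf pos fo.
have ss : size s = k by move: sf; rewrite fs size_prod_XsubC => -[].
pose l := lagrange_basis s; pose w t := L (l t).
have root_orth (p : {poly R}) n : (size p <= n + k)%N -> (n <= maxn k (N - k))%N ->
    (forall t, t \in s -> p.[t] = 0) -> L p = 0.
  move=> sp nk p0.
  have : f %| p.
    rewrite fs; apply: uniq_roots_dvdp; last by rewrite uniq_rootsE.
    by apply/allP => t /p0 pt; apply/rootP.
  move=> /dvdpP[q pq].
  have [q0|q0] := eqVneq q 0; first by rewrite pq q0 mul0r linear0.
  rewrite pq mulrC fo //; apply: leq_trans nk.
  by move: sp; rewrite pq size_Mmonic // sf addnS /= leq_add2r.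
have quad (p : {poly R}) : (size p <= N)%N -> L p = \sum_(t <- s) w t * p.[t].
  move=> sp; pose r := p - \sum_(t <- s) p.[t] *: l t.
  have : L r = 0.
    apply: (root_orth r (N - k)%N); last 2 first.
    - by rewrite leq_max leqnn orbT.
    - move=> u us'; rewrite hornerD hornerN horner_sum (big_rem u us') /=.
      rewrite hornerZ lagrange_basisE // eqxx mulr1 big_seq big1 ?addr0 ?subrr // => t.
      rewrite mem_rem_uniq // inE => /andP[tu ts].
      by rewrite hornerZ lagrange_basisE // eq_sym (negbTE tu) mulr0.
    have kN' : (k <= N - k + k)%N by lia.
    apply: leq_trans (size_polyD _ _) _; rewrite geq_max size_polyN; apply/andP; split.
      by apply: leq_trans sp _; lia.
    apply: leq_trans kN'; rewrite -ss big_seq.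
    apply: (big_ind (fun p : {poly R} => (size p <= size s)%N)) => [|p1 p2 h1 h2|t ts].
    - by rewrite size_poly0.
    - by apply: leq_trans (size_polyD _ _) _; rewrite geq_max h1.
    - by apply: leq_trans (size_scale_leq _ _) _; apply: size_lagrange_basis.
  rewrite linearB linear_sum /= => /eqP; rewrite subr_eq0 => /eqP ->.
  by apply: eq_bigr => t _; rewrite linearZ mulrC.
(* f X^(N-k) is monic of degree N and vanishes at the nodes, so subtracting it from X^N gives degree
   < N without changing the nodal values. *)
pose c := L (f * 'X^(N - k)).
exists s, w, c; split.
- move=> t ts; split; first exact: s0.
  have sl : (size (l t) <= k)%N by rewrite -ss size_lagrange_basis.
  have k0 : (0 < k)%N by rewrite -ss; case: (s) ts.
  (* The difference of l_t^2 and l_t vanishes at all nodes, so the weight is the value of L on a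
     square. *)
  have <- : L (l t ^+ 2) = w t.
    apply/eqP; rewrite -subr_eq0 -linearB; apply/eqP/(root_orth _ k.-1).
    + apply: leq_trans (size_polyD _ _) _; rewrite geq_max size_polyN; apply/andP; split.
        apply: leq_trans (size_polyMleq _ _) _; rewrite -subn1.
        by apply: leq_trans (leq_sub2r 1 (leq_add sl sl)) _; lia.
      by apply: leq_trans sl _; lia.
    + by lia.
    + move=> u us'; rewrite hornerD hornerN horner_exp lagrange_basisE //.
      by case: (u == t); rewrite ?expr1n ?expr0n /= subrr.
  have := Lp false k.-1 (l t); rewrite expr0 mul1r prednK //; apply=> //.
  by move: kN k0; lia.
- have [kN2|kN2] := ltnP N k.*2.
    (* Here 2k = N + 1, and orthogonality up to degree k - 1 = N - k gives c = 0. *)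
    by rewrite /c fo // size_polyXn leq_max; lia.
  have [e [a eaE]] : exists (e : bool) a, (N - k.*2 = e + a.*2)%N.
    by exists (odd (N - k.*2)), (N - k.*2)./2; rewrite odd_double_half.
  (* X^(N-k) and X^(N-2k) f are monic of the same degree; their difference has degree < N - k and is
     orthogonal to f. *)
  have -> : c = L ('X^e * ('X^a * f) ^+ 2).
    apply/eqP; rewrite -subr_eq0 -linearB; apply/eqP.
    have -> : f * 'X^(N - k) - 'X^e * ('X^a * f) ^+ 2 =
        f * ('X^(N - k) - 'X^(e + a.*2) * f).
      by rewrite exprD -muln2 exprM; ring.
    apply: fo; rewrite leq_max -eaE; apply/orP; right.
    apply/leq_sizeP => j jN; rewrite coefB coefXn coefXnM ltnNge.
    have -> /= : (N - k.*2 <= j)%N by lia.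
    have [->|jne] := eqVneq j (N - k)%N.
      rewrite (_ : (N - k - (N - k.*2) = k)%N); last by lia.
      by move/monicP: fm; rewrite /lead_coef sf /= => ->; rewrite subrr.
    by rewrite nth_default ?subrr // sf; lia.
  apply: (Lp e (k + a)%N); last by lia.
  by rewrite addnC -addnS size_XnM_leq ?sf.
- move=> n; rewrite leq_eqVlt => /orP[/eqP ->|nN]; last first.
    rewrite quad ?size_polyXn // (ltn_eqF nN) addr0.
    by apply: eq_bigr => t _; rewrite hornerXn.
  rewrite eqxx mulr1n -[LHS](subrK c) -linearB quad.
    congr (_ + c); rewrite big_seq [RHS]big_seq; apply: eq_bigr => t ts; congr (_ * _).
    rewrite hornerD hornerN hornerM !hornerXn.
    by rewrite (_ : f.[t] = 0) ?mul0r ?subr0 // fs; apply/rootP; rewrite root_prod_XsubC.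
  apply/leq_sizeP => j jN; rewrite coefB coefXn mulrC coefXnM.
  have kN1 : (k <= N)%N by lia.
  have -> /= : (j < N - k)%N = false by apply/negbTE; lia.
  have [->|jne] := eqVneq j N.
    rewrite (_ : (N - (N - k) = k)%N); last by lia.
    by move/monicP: fm; rewrite /lead_coef sf /= => ->; rewrite subrr.
  by rewrite nth_default ?subrr // sf; lia.
Qed.

(** * Diagonal symmetric states *)

Section DiagonalSymmetric.
Local Open Scope complex_scope.
Local Open Scope sesquilinear_scope.
Variable R : realType.
Implicit Types (d N : nat).

(** * Positive semidefinite matrices *)

Lemma psd_gram d n (X : 'M[R[i]]_(n, d)) : psd (X ^t* *m X).
Proof.
split.
  by apply/is_hermitianmxP; rewrite expr0 scale1r trmx_mul map_mxM trmxCK.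
move=> v; have -> : v ^t* *m (X ^t* *m X) *m v = (X *m v) ^t* *m (X *m v).
  by rewrite trmx_mul map_mxM !mulmxA.
by rewrite mxE sumr_ge0 // => i _; rewrite !mxE mulrC mul_conjC_ge0.
Qed.

(** By the spectral theorem X can be sqrt(D) P, with D the eigenvalues and P unitary. Closure of
    [psd] under scaling, transposition and tensor products then reduces to Gram matrices. *)
Lemma psd_factor d (M : 'M[R[i]]_d) : psd M -> exists X : 'M[R[i]]_d, M = X ^t* *m X.
Proof.
move=> [hM pM]; have /hermitian_normalmx/orthomx_spectralP := hM.
set P := spectralmx M; set D := spectral_diag M => ME.
have Pu : P \is unitarymx by exact: spectral_unitarymx.
rewrite invmx_unitary // in ME.
have D0 i : 0 <= D 0 i.
  have := pM (P ^t* *m delta_mx i 0).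
  rewrite ME trmx_mul map_mxM trmxCK !mulmxA.
  rewrite -[_ *m P *m P ^t*]mulmxA (elimT unitarymxP Pu) mulmx1.
  rewrite -[_ *m P *m P ^t*]mulmxA (elimT unitarymxP Pu) mulmx1.
  rewrite trmx_delta map_delta_mx -rowE -colE !mxE eqxx mulr1n; exact.
exists (diag_mx (map_mx sqrtC D) *m P).
rewrite trmx_mul map_mxM tr_diag_mx map_diag_mx !mulmxA ME.
rewrite -[_ *m diag_mx _ *m diag_mx _]mulmxA mulmx_diag; congr (_ *m diag_mx _ *m _).
apply/rowP => i; rewrite !mxE /=.
by rewrite (conj_Creal (ger0_real _)) ?sqrtC_ge0 // -expr2 sqrtCK.
Qed.

Lemma psd0 d : psd (0 : 'M[R[i]]_d).
Proof. by have := psd_gram (0 : 'M[R[i]]_(d, d)); rewrite mulmx0. Qed.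

Lemma psdD d (A B : 'M[R[i]]_d) : psd A -> psd B -> psd (A + B).
Proof.
move=> [/is_hermitianmxP hA pA] [/is_hermitianmxP hB pB]; split.
  by apply/is_hermitianmxP; rewrite linearD map_mxD scalerDr -hA -hB.
by move=> v; rewrite mulmxDr mulmxDl mxE addr_ge0.
Qed.

Lemma psdZ d (c : R) (A : 'M[R[i]]_d) : 0 <= c -> psd A -> psd (c%:C *: A).
Proof.
move=> c0 /psd_factor[X ->].
have cC : 0 <= c%:C by rewrite ler0c.
have -> : c%:C *: (X ^t* *m X) = (sqrtC c%:C *: X) ^t* *m (sqrtC c%:C *: X).
  rewrite [(_ *: X)^T]linearZ /= map_mxZ -scalemxAl -scalemxAr scalerA /=.
  by rewrite (conj_Creal (ger0_real _)) ?sqrtC_ge0 // -expr2 sqrtCK.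
exact: psd_gram.
Qed.

Lemma psd_tr d (A : 'M[R[i]]_d) : psd A -> psd A^T.
Proof.
move=> /psd_factor[X ->]; rewrite trmx_mul.
have -> : X^T *m (X ^t*)^T = (map_mx Num.Def.conjC X) ^t* *m map_mx Num.Def.conjC X.
  by rewrite !map_trmx !trmxK -map_mx_comp (map_mx_id (@conjCK _)).
exact: psd_gram.
Qed.

(** * Tensor products and the easy implication *)

Lemma tensor_op_adj N (X : 'I_N -> 'M[R[i]]_2) :
  tensor_op (fun k => (X k) ^t*) = (tensor_op X) ^t*.
Proof.
apply/matrixP => i j; rewrite !mxE rmorph_prod.
by apply: eq_bigr => k _; rewrite !mxE.
Qed.

Lemma tensor_op_mul N (X Y : 'I_N -> 'M[R[i]]_2) :
  tensor_op (fun k => X k *m Y k) = tensor_op X *m tensor_op Y.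
Proof.
apply/matrixP => i j; rewrite !mxE.
under eq_bigr do rewrite mxE.
rewrite bigA_distr_bigA (reindex (@label N)) /=; last first.
  by exists enum_rank => x _; rewrite /label ?enum_rankK ?enum_valK.
by apply: eq_bigr => l _; rewrite !mxE -big_split.
Qed.

Lemma tr_tensor_op N (X : 'I_N -> 'M[R[i]]_2) :
  \tr (tensor_op X) = \prod_k \tr (X k).
Proof.
rewrite /mxtrace bigA_distr_bigA (reindex (@label N)) /=; last first.
  by exists enum_rank => x _; rewrite /label ?enum_rankK ?enum_valK.
by apply: eq_bigr => l _; rewrite !mxE.
Qed.

Lemma psd_tensor_op N (a : 'I_N -> 'M[R[i]]_2) :
  (forall k, psd (a k)) -> psd (tensor_op a).
Proof.
move=> pa.
have /fin_all_exists[X aX] k : exists X : 'M[R[i]]_2, a k = X ^t* *m X.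
  exact: psd_factor.
have -> : tensor_op a = (tensor_op X) ^t* *m tensor_op X.
  rewrite -tensor_op_adj -tensor_op_mul; apply/matrixP => i j; rewrite !mxE.
  by apply: eq_bigr => k _; rewrite aX.
exact: psd_gram.
Qed.

(** Partial transposition is linear, and on a product it transposes some factors, which stay
    positive semidefinite. *)
Lemma separable_ppt N (rho : 'M[R[i]]_(qdim N)) : separable rho -> ppt rho.
Proof.
move=> [m [p [a [p0 _ sa ->]]]] A.
have -> : ptranspose A (\sum_(l < m) (p l)%:C *: tensor_op (a l)) =
    \sum_(l < m) (p l)%:C *: ptranspose A (tensor_op (a l)).
  apply/matrixP => i j; rewrite mxE !summxE.
  by apply: eq_bigr => l _; rewrite !mxE.
apply: big_ind => [||l _]; [exact: psd0|exact: psdD|].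
apply: psdZ => //; rewrite ptranspose_tensor_op; apply: psd_tensor_op => k.
by case: ifP => _; [apply: psd_tr|]; case: (sa l k).
Qed.

(** * Matrix entries of diagonal symmetric operators *)

Definition zeros N (x : bits N) : nat := #|[set k | x k == 0]|.

Lemma zeros_le N (x : bits N) : (zeros x <= N)%N.
Proof. by rewrite (leq_trans (max_card _)) // card_ord. Qed.

Lemma ketE N (x : bits N) : ket R x = delta_mx (enum_rank x) 0.
Proof.
apply/matrixP => i j; rewrite !mxE (ord1 j) andbT.
rewrite -(inj_eq (@enum_val_inj _ _)) enum_rankK -/(label i).
have [->|neq] := eqVneq (label i) x.
  by rewrite big1 // => k _; rewrite mxE !eqxx.
have [k nk] : exists k, label i k != x k.
  apply/existsP; rewrite -negb_forall; apply: contraNN neq => /forallP h.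
  by apply/eqP/ffunP => k; apply/eqP.
by rewrite (bigD1 k) //= mxE (negbTE nk) mul0r.
Qed.

Lemma dickeE N n i : dicke R N n i 0 = (zeros (label i) == n)%:R.
Proof.
rewrite summxE big_mkcond (bigD1 (label i)) //= ketE mxE /label enum_valK !eqxx.
rewrite big1 ?addr0 => [|x ne]; first by rewrite /zeros; case: ifP.
case: ifP => // _; rewrite ketE mxE andbT; case: eqP => // E.
by case/eqP: ne; rewrite /= E enum_rankK.
Qed.

(** Every basis string occurs in exactly one Dicke vector, so at most one summand contributes to an
    entry. *)
Lemma gdsE N (chi : 'I_N.+1 -> R[i]) i j :
  gds chi i j = if zeros (label i) == zeros (label j)
                then chi (inord (zeros (label i))) else 0.
Proof.
rewrite summxE (bigD1 (inord (zeros (label i)))) //= big1 ?addr0 => [|n ne].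
  rewrite !mxE big_ord1 !mxE !dickeE inordK ?ltnS ?zeros_le // eqxx eq_sym mul1r.
  by case: eqP => _; rewrite ?conjC1 ?conjC0 ?mulr1 ?mulr0.
rewrite !mxE big_ord1 !mxE dickeE.
case: eqP => [E|_]; last by rewrite mul0r mulr0.
by case/eqP: ne; rewrite E inord_val.
Qed.

(* Separability without normalization. *)
Definition sepcone N (M : 'M[R[i]]_(qdim N)) : Prop :=
  exists (m : nat) (p : 'I_m -> R) (a : 'I_m -> 'I_N -> 'M[R[i]]_2),
    [/\ forall l, 0 <= p l, forall l k, is_state (a l k) &
        M = \sum_(l < m) (p l)%:C *: tensor_op (a l)].

(** * The cone of separable operators *)

(** Product states have trace one, so the weights sum to the trace of [M]. *)
Lemma sepcone_separable N (M : 'M[R[i]]_(qdim N)) :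
  sepcone M -> \tr M = 1 -> separable M.
Proof.
move=> [m [p [a [p0 sa ME]]]] tM; exists m, p, a; split=> //.
apply: (@complexI R); rewrite rmorph_sum rmorph1 -tM ME linear_sum.
apply: eq_bigr => l _; rewrite linearZ /= tr_tensor_op big1 ?mulr1 // => k _.
by case: (sa l k).
Qed.

Lemma sepcone0 N : sepcone (0 : 'M[R[i]]_(qdim N)).
Proof.
exists 0%N, (fun=> 0), (fun _ _ => 0); split; [by case|by case|by rewrite big_ord0].
Qed.

Lemma sepconeD N (A B : 'M[R[i]]_(qdim N)) : sepcone A -> sepcone B -> sepcone (A + B).
Proof.
move=> [m [p [a [p0 sa ->]]]] [n [q [b [q0 sb ->]]]].
exists (m + n)%N, (fun l => match split l with inl i => p i | inr j => q j end),
  (fun l => match split l with inl i => a i | inr j => b j end); split.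
- by move=> l; case: split.
- by move=> l; case: split.
rewrite big_split_ord /=; congr (_ + _); apply: eq_bigr => l _.
  by rewrite (unsplitK (inl l)).
by rewrite (unsplitK (inr l)).
Qed.

Lemma sepconeZ N (c : R) (A : 'M[R[i]]_(qdim N)) :
  0 <= c -> sepcone A -> sepcone (c%:C *: A).
Proof.
move=> c0 [m [p [a [p0 sa ->]]]]; exists m, (fun l => c * p l), a; split=> //.
  by move=> l; rewrite mulr_ge0.
by rewrite scaler_sumr; apply: eq_bigr => l _; rewrite scalerA rmorphM.
Qed.

Lemma sepcone_tensor_op N (a : 'M[R[i]]_2) (c : R) :
  psd a -> 0 < c -> \tr a = c%:C -> sepcone (tensor_op (fun _ : 'I_N => a)).
Proof.
move=> pa c0 ta; pose b := (c^-1)%:C *: a.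
have cC : c%:C != 0 by rewrite fmorph_eq0 gt_eqF.
have -> : tensor_op (fun _ : 'I_N => a) = (c ^+ N)%:C *: tensor_op (fun _ : 'I_N => b).
  apply/matrixP => i j; rewrite !mxE.
  have -> : (c ^+ N)%:C = \prod_(k < N) c%:C by rewrite prodr_const card_ord rmorphXn.
  rewrite -big_split; apply: eq_bigr => k _.
  by rewrite /= [b _ _]mxE mulrA -rmorphM divff ?gt_eqF // rmorph1 mul1r.
apply: sepconeZ; first by rewrite exprn_ge0 // ltW.
exists 1%N, (fun=> 1), (fun _ _ => b); split=> //; last first.
  by rewrite big_ord1 rmorph1 scale1r.
move=> _ _; split; first by apply: psdZ => //; rewrite invr_ge0 ltW.
by rewrite linearZ /= ta -rmorphM mulVf ?gt_eqF.
Qed.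

(** * Averaging over roots of unity *)

(** X^n - 1 is separable, so it has n distinct roots, and n distinct n-th roots of unity include a
    primitive one. *)
Lemma prim_root_exists (F : closedFieldType) n : n%:R != 0 :> F -> (0 < n)%N ->
  exists z : F, n.-primitive_root z.
Proof.
move=> nF n_gt0; pose p : {poly F} := 'X^n - 1.
have [r Dp] := closed_field_poly_normal p.
rewrite (monicP _) ?monicXnsubC // scale1r in Dp.
have rn1 : all n.-unity_root r by apply/allP=> z; rewrite -root_prod_XsubC -Dp.
have sz_r : (n < (size r).+1)%N by rewrite -(size_prod_XsubC r id) -Dp size_XnsubC.
have [|z] := hasP (has_prim_root n_gt0 rn1 _ sz_r); last by exists z.
by rewrite -separable.separable_prod_XsubC -Dp cyclotomic.separable_Xn_sub_1.
Qed.

Lemma mul_conj_prim_root n (w : R[i]) : n.+1.-primitive_root w -> w * w^*%R = 1.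
Proof.
move=> wp; have w1 : `|w| = 1.
  apply/eqP; rewrite -(@pexpr_eq1 _ _ n.+1) ?normr_ge0 //.
  by rewrite -normrX (prim_expr_order wp) normr1.
by rewrite -normCK w1 expr1n.
Qed.

(** A geometric sum with ratio q = w^(a-b) and q^(N+1) = 1; since a, b <= N, the ratio is 1 only for
    a = b. *)
Lemma sum_prim_root N (w : R[i]) a b : N.+1.-primitive_root w ->
  (a <= N)%N -> (b <= N)%N ->
  \sum_(j < N.+1) (w ^+ j) ^+ a * ((w ^+ j)^*)%R ^+ b = (a == b)%:R * N.+1%:R.
Proof.
move=> wp aN bN; have wN := prim_expr_order wp.
have ww := mul_conj_prim_root wp.
pose q := w ^+ a * w^*%R ^+ b.
have qN : q ^+ N.+1 = 1.
  rewrite exprMn -!exprM ![(_ * N.+1)%N]mulnC !exprM.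
  by rewrite -rmorphXn /= wN rmorph1 !expr1n mulr1.
have -> : \sum_(j < N.+1) (w ^+ j) ^+ a * ((w ^+ j)^*)%R ^+ b = \sum_(j < N.+1) q ^+ j.
  apply: eq_bigr => j _; rewrite exprMn rmorphXn /= -!exprM.
  by rewrite ![(_ * j)%N]mulnC.
have [E|ne] := eqVneq a b.
  rewrite /q E -exprMn ww expr1n mul1r; under eq_bigr do rewrite expr1n.
  by rewrite sumr_const card_ord.
have q1 : q - 1 != 0.
  rewrite subr_eq0; apply: contra ne => /eqP q1.
  have : w ^+ a == w ^+ b.
    have -> : w ^+ a = q * w ^+ b.
      by rewrite /q -mulrA [_ * w ^+ b]mulrC -exprMn ww expr1n mulr1.
    by rewrite q1 mul1r.
  by rewrite (eq_prim_root_expr wp) !modn_small.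
apply/eqP; rewrite mul0r -(inj_eq (mulfI q1)) mulr0 -subrX1 qN subrr //.
Qed.

Lemma prod_bits N (x : bits N) (z u : R[i]) :
  \prod_(k < N) (if x k == 0 then z else u) = z ^+ zeros x * u ^+ (N - zeros x).
Proof.
rewrite (bigID (fun k => x k == 0)) /=; congr (_ * _).
  rewrite (eq_bigr (fun=> z)) => [|k ->//].
  by rewrite prodr_const /zeros cardsE.
rewrite (eq_bigr (fun=> u)) => [|k /negbTE ->//].
rewrite prodr_const; congr (_ ^+ _).
have -> : (N - zeros x)%N = #|~: [set k | x k == 0]| by rewrite cardsCs setCK card_ord.
by apply: eq_card => k; rewrite !inE.
Qed.

(** Averaging over the phases w^j cancels the entries between strings with different numbers of
    zeros. The homogeneous form in (t, u) includes the point at infinity (1, 0). *)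
Lemma sepcone_gds_point N (t u : R) : 0 <= t -> 0 <= u -> 0 < t + u ->
  sepcone (gds (fun n : 'I_N.+1 => (t ^+ n * u ^+ (N - n))%:C)).
Proof.
move=> t0 u0 tu.
have [w wp] : exists w : R[i], N.+1.-primitive_root w.
  by apply: prim_root_exists => //; rewrite pnatr_eq0.
have ww := mul_conj_prim_root wp.
pose st := (Num.sqrt t)%:C; pose su := (Num.sqrt u)%:C.
have stR : st^*%R = st by rewrite conj_Creal // ger0_real // ler0c sqrtr_ge0.
have suR : su^*%R = su by rewrite conj_Creal // ger0_real // ler0c sqrtr_ge0.
have st2 : st ^+ 2 = t%:C by rewrite -rmorphXn /= sqr_sqrtr.
have su2 : su ^+ 2 = u%:C by rewrite -rmorphXn /= sqr_sqrtr.
pose v j : 'cV[R[i]]_2 := \col_b (if b == 0 then st * w ^+ j else su).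
have -> : gds (fun n : 'I_N.+1 => (t ^+ n * u ^+ (N - n))%:C) =
  \sum_(j < N.+1) (N.+1%:R^-1)%:C *: tensor_op (fun _ : 'I_N => v j *m (v j) ^t*).
  apply/matrixP => i j; rewrite gdsE summxE.
  set x := label i; set y := label j.
  have E (l : 'I_N.+1) :
      ((N.+1%:R^-1)%:C *: tensor_op (fun _ : 'I_N => v l *m (v l) ^t*)) i j =
      N.+1%:R^-1 * (st ^+ (zeros x + zeros y) * su ^+ (N - zeros x + (N - zeros y))) *
      ((w ^+ l) ^+ zeros x * ((w ^+ l)^*)%R ^+ zeros y).
    rewrite !mxE fmorphV rmorph_nat -/x -/y.
    have -> : \prod_(k < N) (v l *m (v l) ^t*) (x k) (y k) =
       (\prod_(k < N) (if x k == 0 then st * w ^+ l else su)) *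
       (\prod_(k < N) (if y k == 0 then st * (w ^+ l)^*%R else su)).
      rewrite -big_split; apply: eq_bigr => k _; rewrite !mxE big_ord1 !mxE.
      by congr (_ * _); case: ifP => _; rewrite ?rmorphM /= ?stR.
    rewrite !prod_bits !exprMn !exprD -[RHS]mulrA; congr (_ * _).
    by rewrite mulrACA [RHS]mulrAC; congr (_ * _); exact: mulrACA.
  rewrite (eq_bigr _ (fun l _ => E l)) -mulr_sumr sum_prim_root ?zeros_le //.
  case: eqP => [->|_]; last by rewrite mul0r mulr0.
  rewrite inordK ?ltnS ?zeros_le // mul1r [RHS]mulrAC mulVf ?pnatr_eq0 // mul1r.
  by rewrite !addnn -!muln2 ![(_ * 2)%N]mulnC !exprM st2 su2 rmorphM !rmorphXn.
apply: big_ind => [||j _]; [exact: sepcone0|exact: sepconeD|].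
apply: sepconeZ; first by rewrite invr_ge0.
apply: (@sepcone_tensor_op _ _ (t + u)) => //.
  by have := psd_gram ((v j) ^t*); rewrite trmxCK.
rewrite /mxtrace !big_ord_recl big_ord0 addr0 !mxE !big_ord1 !mxE /= rmorphM /= stR suR.
rewrite -[su * su]expr2 su2 rmorphXn /= mulrACA -expr2 st2 -exprMn ww expr1n mulr1.
by rewrite rmorphD.
Qed.

(** * From moments to separability *)

Definition moment_functional N (c : 'I_N.+1 -> R) (p : {poly R}) : R :=
  \sum_(n < N.+1) c n * p`_n.

Lemma moment_functional_is_scalar N (c : 'I_N.+1 -> R) : scalar (moment_functional c).
Proof.
move=> a p q; rewrite /moment_functional mulr_sumr -big_split.
by apply: eq_bigr => n _; rewrite /= coefD coefZ; ring.
Qed.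

HB.instance Definition _ N (c : 'I_N.+1 -> R) :=
  GRing.isLinear.Build R {poly R} R _
    (moment_functional c) (moment_functional_is_scalar c).

Lemma moment_functionalXn N (c : 'I_N.+1 -> R) n :
  (n <= N)%N -> moment_functional c 'X^n = c (inord n).
Proof.
move=> nN; rewrite /moment_functional (bigD1 (inord n)) //= big1 ?addr0.
  by rewrite coefXn inordK ?ltnS // eqxx mulr1.
move=> i ne; rewrite coefXn; case: eqP => [E|]; last by rewrite mulr0.
by case/eqP: ne; rewrite -E inord_val.
Qed.

Lemma gds_separable_of_stieltjes N (c : 'I_N.+1 -> R) :
  stieltjes_pos N (moment_functional c) -> sepcone (gds (fun n => (c n)%:C)).
Proof.
move=> /truncated_stieltjes[s [w [c1 [sw c10 cE]]]].
(* A finite node t is the point (t, 1); the atom at infinity is (1, 0), because 0^(N-n) = [n = N]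
   with 0^0 = 1. *)
have -> : gds (fun n => (c n)%:C) =
    \sum_(t <- s) (w t)%:C *: gds (fun n : 'I_N.+1 => (t ^+ n * 1 ^+ (N - n))%:C) +
    c1%:C *: gds (fun n : 'I_N.+1 => (1 ^+ n * 0 ^+ (N - n))%:C).
  apply/matrixP => i j; rewrite gdsE mxE summxE [in RHS]mxE gdsE.
  under eq_bigr do rewrite mxE gdsE.
  case: eqP => _; last by rewrite big1 ?mulr0 ?addr0 // => t _; rewrite mulr0.
  have zN := zeros_le (label i).
  rewrite -moment_functionalXn // cE // inordK ?ltnS // rmorphD rmorph_sum /=.
  congr (_ + _).
    by apply: eq_bigr => t _; rewrite expr1n mulr1 rmorphM.
  rewrite expr1n mul1r -rmorphM expr0n subn_eq0 eqn_leq zN /=.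
  by case: leqP => _; rewrite ?mulr1 ?mulr0.
apply: sepconeD; last first.
  by apply: sepconeZ => //; apply: sepcone_gds_point => //; rewrite addr0.
rewrite big_seq; apply: big_ind => [||t ts]; [exact: sepcone0|exact: sepconeD|].
have [t0 w0] := sw t ts.
by apply: sepconeZ => //; apply: sepcone_gds_point => //; apply: ltr_wpDl.
Qed.

(** * Partial transposes and test vectors *)

Definition zeros_in N (A : {set 'I_N}) (x : bits N) : nat :=
  #|A :&: [set k | x k == 0]|.

Lemma zeros_in_setC N (A : {set 'I_N}) (x : bits N) :
  zeros x = (zeros_in A x + zeros_in (~: A) x)%N.
Proof.
rewrite /zeros /zeros_in -(cardsID A [set k | x k == 0]) setDE.
by rewrite ![_ :&: [set k | x k == 0]]setIC.
Qed.

Lemma zeros_splice N (A : {set 'I_N}) (x y : bits N) :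
  zeros (splice A x y) = (zeros_in A y + zeros_in (~: A) x)%N.
Proof.
rewrite (zeros_in_setC A); congr (_ + _)%N; apply: eq_card => k;
  by rewrite !inE ffunE; case: (k \in A).
Qed.

Lemma subset_of_card (T : finType) (A : {set T}) n : (n <= #|A|)%N ->
  exists B : {set T}, B \subset A /\ #|B| = n.
Proof.
move=> nA; exists [set x in take n (enum A)]; split.
  by apply/subsetP => x; rewrite inE => /mem_take; rewrite mem_enum.
rewrite cardsE (card_uniqP _) ?take_uniq ?enum_uniq // size_takel //.
by rewrite -cardE.
Qed.

Lemma bits_of_zeros_in N (A : {set 'I_N}) a b : (a <= #|A|)%N -> (b <= #|~: A|)%N ->
  exists x : bits N, zeros_in A x = a /\ zeros_in (~: A) x = b.
Proof.
move=> /subset_of_card[B [/subsetP BA <-]] /subset_of_card[C [/subsetP CA <-]].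
exists [ffun k => if k \in B :|: C then 0 else 1].
have E k : ((if k \in B :|: C then 0 else 1 : 'I_2) == 0) = (k \in B :|: C).
  by case: ifP.
split; apply: eq_card => k; rewrite !inE ffunE E !inE;
have := BA k; have := CA k; rewrite inE;
by case: (k \in A) (k \in B) (k \in C) => [] [] [] //= h1 h2; rewrite ?(h1 isT) ?(h2 isT).
Qed.

Lemma ket_form N (M : 'M[R[i]]_(qdim N)) (x y : bits N) :
  ((ket R x) ^t* *m M *m ket R y) 0 0 = M (enum_rank x) (enum_rank y).
Proof. by rewrite !ketE trmx_delta map_delta_mx -rowE -colE !mxE. Qed.

Lemma gds_coef_ge0 N (chi : 'I_N.+1 -> R[i]) n : psd (gds chi) -> 0 <= chi n.
Proof.
move=> [_ /= pos].
have [||x [_ xn]] := @bits_of_zeros_in N set0 0 n; first by [].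
  by rewrite setC0 cardsT card_ord -ltnS.
have := pos (ket R x); rewrite ket_form gdsE eqxx /label enum_rankK.
by rewrite (zeros_in_setC set0) xn /zeros_in set0I cards0 add0n inord_val.
Qed.

(* Test vector: the sum over s of f_s |x_s>, where x_s has s zeros in A and
   s + e zeros off A; the entry of the partial transpose at (x_r, x_s) is then
   chi_(r + s + e). *)
Lemma psd_ptranspose_stieltjes N (c : 'I_N.+1 -> R) (A : {set 'I_N}) :
  #|A| = (N %/ 2)%N -> psd (ptranspose A (gds (fun n => (c n)%:C))) ->
  stieltjes_pos N (moment_functional c).
Proof.
move=> cA [_ pos] e d f sf ed.
have cC : #|~: A| = (N - N %/ 2)%N by rewrite cardsCs setCK card_ord cA.
(* The size of A enters here: e + 2d <= N gives s <= floor(N/2) and s + e <= ceil(N/2), so both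
   counts fit. *)
have ex (s : 'I_d.+1) : exists x : bits N,
    zeros_in A x = s /\ zeros_in (~: A) x = (s + e)%N.
  by apply: bits_of_zeros_in; rewrite ?cA ?cC; move: (ltn_ord s) ed; case: e => /=; lia.
have [x xE] := fin_all_exists ex.
have := pos (\sum_(s < d.+1) (f`_s)%:C *: ket R (x s)).
rewrite mulmx_sumr summxE.
suff -> : \sum_(s < d.+1) (((\sum_(s < d.+1) (f`_s)%:C *: ket R (x s)) ^t* *m
   ptranspose A (gds (fun n => (c n)%:C)) *m ((f`_s)%:C *: ket R (x s))) 0 0) =
   (moment_functional c ('X^e * f ^+ 2))%:C by rewrite ler0c.
have -> : 'X^e * f ^+ 2 =
    \sum_(s < d.+1) \sum_(r < d.+1) (f`_s * f`_r) *: 'X^(r + (s + e)).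
  have fE : f = \sum_(s < d.+1) f`_s *: 'X^s.
    rewrite -poly_def; apply/polyP => i; rewrite coef_poly.
    by case: ltnP => // h; rewrite nth_default // (leq_trans sf).
  rewrite expr2 {1}fE mulr_suml mulr_sumr; apply: eq_bigr => s _.
  rewrite [X in _ * (_ * X) = _]fE !mulr_sumr; apply: eq_bigr => r _.
  by rewrite -!mul_polyC !exprD polyCM; ring.
rewrite [in RHS]linear_sum [in RHS]rmorph_sum; apply: eq_bigr => s _.
rewrite [in RHS]linear_sum [in RHS]rmorph_sum raddf_sum map_mx_sum.
rewrite !mulmx_suml summxE; apply: eq_bigr => r _.
rewrite /= [(_ *: _)^T]linearZ map_mxZ /= -!scalemxAl -scalemxAr.
rewrite [in RHS]linearZ /= [LHS]mxE [X in _ * X]mxE.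
rewrite ket_form mxE gdsE /label !enum_rankK !zeros_splice.
have [-> ->] := xE r; have [-> ->] := xE s.
rewrite moment_functionalXn; last first.
  by move: (ltn_ord s) (ltn_ord r) ed; case: e {pos ex x xE} => /=; lia.
(* After the exchange on A the row string has s + (r + e) zeros and the column string r + (s + e):
   the counts agree, so the entry is a coefficient and not 0. *)
rewrite addnCA eqxx conj_Creal; last by rewrite realE ler0c lecR real_leVge ?num_real.
rewrite mulrA -!rmorphM [f`_r * _]mulrC //.
Qed.

End DiagonalSymmetric.

Theorem theorem2 (R : realType) (N : nat) (hN : (1 <= N)%N)
    (chi : 'I_N.+1 -> R[i]) (hstate : is_state (gds chi)) :
  (separable (gds chi) <-> ppt (gds chi)) /\
  (forall A : {set 'I_N}, #|A| = (N %/ 2)%N ->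
     (separable (gds chi) <-> psd (ptranspose A (gds chi)))).
Proof.
have half (A : {set 'I_N}) : #|A| = (N %/ 2)%N ->
    psd (ptranspose A (gds chi)) -> separable (gds chi).
  move=> cA pA; have [pos tr1] := hstate.
  apply: sepcone_separable => //.
  (* Positivity of the state makes the complex coefficients real, so the real moment problem
     applies. *)
  have chiE : gds chi = gds (fun n => (complex.Re (chi n))%:C%C).
    apply/matrixP => i j; rewrite !gdsE; case: eqP => // _.
    have := gds_coef_ge0 (inord (zeros (label i))) pos.
    rewrite lecE /= => /andP[/eqP im _].
    by case: (chi _) im => a b /= ->.
  rewrite chiE in pA *; apply: gds_separable_of_stieltjes.
  exact: psd_ptranspose_stieltjes cA pA.
split=> [|A cA]; split=> [|h].
- exact: separable_ppt.
- have [|A [_ cA]] := @subset_of_card _ [set: 'I_N] (N %/ 2)%N.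
    by rewrite cardsT card_ord leq_div.
  exact: half cA (h A).
- by move/separable_ppt; apply.
- exact: half h.
Qed.
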